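(* Let $k,\ell,q$ be nonnegative integers with $k\geq 2\ell+3$. If $G$ is a $q$-tight $(k,\ell)$-stable graph on $n$ vertices, then $$n\leq (q+1)(\ell+1)(k+2q-2\ell-1)^2\, 2^{6(k-2\ell+2q)^2}.$$
   Context: All graphs are finite, simple and undirected. $\alpha(G)$ denotes the independence number of $G$, and $G-S$ denotes the subgraph of $G$ induced on $V(G)\setminus S$. For integers $k>\ell\geq 0$, a graph $G$ is $(k,\ell)$-stable if for every $S\subseteq V(G)$ with $|S|=k$ we have $\alpha(G-S)\geq \alpha(G)-\ell$. For an integer $q\geq 0$, a graph $G$ on $n$ vertices is $q$-tight $(k,\ell)$-stable if $G$ is $(k,\ell)$-stable and $\alpha(G)=\left\lfloor \frac{n-k+1}{2}\right\rfloor+\ell-q$. *)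

(* Defs.v *)
From HB Require Import structures.
From mathcomp Require Import all_boot all_order all_algebra.

Set Implicit Arguments.
Unset Strict Implicit.
Unset Printing Implicit Defensive.

Record sgraph := SGraph {
  vertex :> finType;
  edge : rel vertex;
  edge_sym : symmetric edge;
  edge_irrefl : irreflexive edge }.

Definition independent (G : sgraph) (I : {set G}) : bool :=
  [forall x in I, forall y in I, ~~ edge x y].

Definition alpha (G : sgraph) : nat :=
  \max_(I : {set G} | independent I) #|I|.

Section Induced.
Variables (G : sgraph) (A : {set G}).

Definition induced_edge : rel {x : G | x \in A} :=
  fun x y => edge (val x) (val y).

Lemma induced_edge_sym : symmetric induced_edge.
Proof. by move=> x y; exact: edge_sym. Qed.

Lemma induced_edge_irrefl : irreflexive induced_edge.
Proof. by move=> x; exact: edge_irrefl. Qed.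

Definition induced : sgraph := SGraph induced_edge_sym induced_edge_irrefl.
End Induced.

Definition del_vertices (G : sgraph) (S : {set G}) : sgraph := induced (~: S).

(* Truncated subtraction is harmless here: since alpha (G - S) >= 0, the bound
   is equivalent to the one with the integer difference alpha G - l. *)
Definition kl_stable (k l : nat) (G : sgraph) : Prop :=
  forall S : {set G}, #|S| = k -> alpha G - l <= alpha (del_vertices S).

(* The equation is taken in int, because #|G| - k + 1 and the whole right-hand
   side may be negative; (_ %/ 2)%Z rounds down, i.e. it is the floor. *)
Definition q_tight (q k l : nat) (G : sgraph) : Prop :=
  kl_stable k l G /\
  ((alpha G)%:Z = ((#|G|%:Z - k%:Z + 1)%R %/ 2)%Z + l%:Z - q%:Z)%R.

(* Main.v *)
Require Import Defs.
From HB Require Import structures.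
From mathcomp Require Import all_boot all_order all_algebra.
From mathcomp Require Import zify.

Set Implicit Arguments.
Unset Strict Implicit.
Unset Printing Implicit Defensive.

(* Deleting edges without changing the independence number a keeps G stable and
   tight, so G may be assumed edge-critical: every edge uw lies in a set B of
   a + 1 vertices whose only edge is uw.  Call |N(J)| - |J| the surplus of an
   independent set J.  Put h = k - 2l - 2 >= 1.  Stability forces surplus > h on
   independent sets with more than l vertices, while tightness bounds the surplus
   of maximum independent sets by h + 2q + 2: only 2q + 2 levels are available.

   If K minimises the surplus among its large subsets, then by submodularity two
   critical sets B, B' of distinct edges sharing an end in K or N(K) have a small
   common trace on K.  Match a maximum independent set (minus isolated vertices)
   into its complement; every critical set contains exactly one end of almost
   every matching edge.  Take K and M containing opposite ends of many matching
   edges, with minimal total surplus.  Three edges at a vertex v of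
   (K u N(K)) n (M u N(M)) are impossible: on each matching edge two of the three
   critical sets agree, so some two agree often, on the K side or on the M side.
   Hence all degrees there are at most 2, and sliding critical sets along the
   resulting paths gives a contradiction.  So any two sets of bounded surplus are
   opposite on few matching edges only; then the critical sets of two edges
   sharing an end v in K have a large common trace on K, a contradiction as soon
   as the number of matching edges is large.  All losses are by factors 6 per
   level, which gives a bound linear in l. *)

(** * Neighbourhoods, surplus and critical sets *)

Section Graph.
Variables (T : finType) (e : rel T).
Implicit Types (A B J K S : {set T}) (u v w x y : T).

Definition indep A := [forall x in A, forall y in A, ~~ e x y].
Definition nbh A := [set y | [exists x in A, e x y]].

Lemma indepP A : reflect {in A &, forall x y, ~~ e x y} (indep A).
Proof.
apply: (iffP forall_inP) => [h x y xA yA | h x xA]; first by move/forall_inP: (h x xA); apply.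
by apply/forall_inP => y yA; apply: h.
Qed.

Lemma nbhP A y : reflect (exists2 x, x \in A & e x y) (y \in nbh A).
Proof. by rewrite inE; apply: (iffP exists_inP). Qed.

Lemma indepS A B : A \subset B -> indep B -> indep A.
Proof.
move=> sAB /indepP h; apply/indepP => x y xA yA.
by apply: h; apply: (subsetP sAB).
Qed.

Lemma nbhS A B : A \subset B -> nbh A \subset nbh B.
Proof.
move=> sAB; apply/subsetP => y /nbhP[x xA exy].
by apply/nbhP; exists x => //; apply: (subsetP sAB).
Qed.

Lemma nbhU A B : nbh (A :|: B) = nbh A :|: nbh B.
Proof.
apply/setP => y; rewrite in_setU; apply/nbhP/orP => [[x] | ].
  by rewrite inE => /orP[] xA exy; [left | right]; apply/nbhP; exists x.
by case=> /nbhP[x xA exy]; exists x; rewrite // inE xA ?orbT.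
Qed.

Lemma nbh_submod A B :
  #|nbh (A :|: B)| + #|nbh (A :&: B)| <= #|nbh A| + #|nbh B|.
Proof.
rewrite -(cardsUI (nbh A)) nbhU leq_add2l subset_leq_card //.
by rewrite subsetI !nbhS ?subsetIl ?subsetIr.
Qed.

Lemma indep_nbh A : indep A = [disjoint A & nbh A].
Proof.
apply/indepP/idP => [h | /pred0P d].
  apply/pred0P => y /=; apply/negP => /andP[yA /nbhP[x xA exy]].
  by move: (h x y xA yA); rewrite exy.
move=> x y xA yA; apply/negP => exy.
by have := d y; rewrite /= yA => /negbT/negP[]; apply/nbhP; exists x.
Qed.

Hypotheses (e_sym : symmetric e) (e_irr : irreflexive e).

Lemma indepU A B : indep A -> indep B -> [disjoint A & nbh B] -> indep (A :|: B).
Proof.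
move=> /indepP hA /indepP hB /pred0P d.
have nAB x y : x \in A -> y \in B -> ~~ e x y.
  move=> xA yB; apply/negP => exy; have := d x; rewrite /= xA => /negbT/negP[]; apply/nbhP.
  by exists y; rewrite // e_sym.
apply/indepP => x y; rewrite !inE => /orP[] xAB /orP[] yAB; auto.
by rewrite e_sym; auto.
Qed.

Lemma indep1 x : indep [set x].
Proof. by apply/indepP => u v /set1P-> /set1P->; rewrite e_irr. Qed.

Variable a : nat.

(* [B] has one vertex more than a maximum independent set, and [uw] is the only
   edge inside [B]; when [a] is the independence number, [B] witnesses that the
   edge [uw] is critical. *)
Definition near B u w :=
  [&& e u w, u \in B, w \in B, indep (B :\ u), indep (B :\ w) & #|B| == a.+1].

Lemma near_sym B u w : near B u w -> near B w u.
Proof. by case/and5P=> h1 h2 h3 h4 /andP[h5 h6]; rewrite /near e_sym h1 h2 h3 h4 h5. Qed.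

Lemma near_edge B u w x y : near B u w -> x \in B -> y \in B -> e x y ->
  (x = u /\ y = w) \/ (x = w /\ y = u).
Proof.
case/and5P=> euw uB wB /indepP hu /andP[/indepP hw _] xB yB exy.
have /orP xyu : (x == u) || (y == u).
  apply/negPn/negP; rewrite negb_or => /andP[xu yu].
  by have := hu x y; rewrite !inE xu yu xB yB exy => /(_ isT isT).
have /orP xyw : (x == w) || (y == w).
  apply/negPn/negP; rewrite negb_or => /andP[xw yw].
  by have := hw x y; rewrite !inE xw yw xB yB exy => /(_ isT isT).
case: xyu xyw => /eqP-> [] /eqP E; auto.
  by rewrite E e_irr in euw.
by rewrite E e_irr in euw.
Qed.

Hypothesis alpha_max : forall A, indep A -> #|A| <= a.

(** Trade the part of [B] in [nbh K] for the vertices of [K] outside [B]: the result is independent,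
    so it has at most [a] vertices. *)
Lemma exchange K B : indep K -> indep (B :\: nbh K) ->
  #|B| + #|K :\: B| <= a + #|B :&: nbh K|.
Proof.
move=> iK iB; have dK : [disjoint B :\: nbh K & nbh K].
  by rewrite disjoints_subset; apply/subsetP => x; rewrite !inE => /andP[].
have := alpha_max (indepU iB iK dK).
have -> : (B :\: nbh K) :|: K = (B :\: nbh K) :|: (K :\: B).
  apply/setP => x; rewrite !inE; case xB: (x \in B); rewrite ?andbF ?orbF //=.
  case xK: (x \in K); rewrite ?orbF ?orbT //.
  move: iK; rewrite indep_nbh => /pred0P/(_ x)/=; rewrite xK /=.
  by rewrite inE => ->.
rewrite cardsU (_ : _ :&: _ = set0); last first.
  by apply/setP => x; rewrite !inE; case: (x \in B); rewrite ?andbF.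
rewrite cards0 cardsD; have := subset_leq_card (subsetIl B (nbh K)); lia.
Qed.

(** Since [u] lies in [nbh K], the exchange destroys the only edge of [B]; the inequality is strict
    because [B] has [a + 1] vertices. *)
Lemma near_exchange K B u w : indep K -> near B u w -> u \in nbh K ->
  #|K :\: B| < #|B :&: nbh K|.
Proof.
move=> iK /and5P[_ _ _ iB /andP[_ /eqP cB]] uK.
suff : #|B| + #|K :\: B| <= a + #|B :&: nbh K| by lia.
apply: exchange => //; apply: indepS iB.
by apply/subsetP => x; rewrite !inE => /andP[xK ->]; rewrite andbT; apply: contraNneq xK => ->; rewrite inE in uK.
Qed.

Lemma nbh_trace K B w s : #|nbh K| <= #|K| + s -> #|K :\: B| < #|B :&: nbh K| ->
  forall J, J \subset K -> nbh J :&: B \subset [set w] -> #|nbh J| <= #|K :&: B| + s.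
Proof.
move=> hK hB J JK hJ.
have : #|nbh J| <= #|nbh K :\: B| + 1.
  rewrite -(cardsID B (nbh J)) addnC leq_add //; last first.
    by rewrite -(cards1 w) subset_leq_card.
  by rewrite subset_leq_card // setSD // nbhS.
have := cardsID B K; have := cardsID B (nbh K); rewrite (setIC (nbh K)); move: hK hB; clear; lia.
Qed.

(** The only edge from [K :&: B] to [B] is [uw], so the neighbourhood of the trace meets [B] in [w]
    alone, and misses [B] once [u] is removed. *)
Lemma near_inside K B u w s : indep K -> #|nbh K| <= #|K| + s ->
  near B u w -> u \in K ->
  [/\ #|nbh (K :&: B)| <= #|K :&: B| + s, #|nbh ((K :&: B) :\ u)| < #|K :&: B| + s
    & w \notin nbh ((K :&: B) :\ u)].
Proof.
move=> iK hK nB uK; have euw : e u w by case/and3P: nB.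
have wK : w \in nbh K by apply/nbhP; exists u.
have nwK : w \notin K.
  by apply/negP => wK'; have /indepP/(_ u w uK wK') := iK; rewrite euw.
have hB := near_exchange iK (near_sym nB) wK.
have hw x y : x \in K :&: B -> y \in B -> e x y -> x = u /\ y = w.
  rewrite inE => /andP[xK xB] yB exy.
  case: (near_edge nB xB yB exy) => // -[xw _].
  by rewrite -xw xK in nwK.
have h0 : nbh (K :&: B :\ u) :&: B = set0.
  apply/setP => y; rewrite !inE; apply/negP => /andP[/exists_inP[x] ].
  rewrite in_setD1 => /andP[xu xKB] exy yB.
  by have [E _] := hw x y xKB yB exy; rewrite E eqxx in xu.
have hD := near_exchange iK (near_sym nB) wK.
split.
- apply: (@nbh_trace K B w s) => //; first exact: subsetIl.
  apply/subsetP => y; rewrite in_setI => /andP[/nbhP[x xKB exy] yB].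
  by have [_ ->] := hw x y xKB yB exy; rewrite inE.
- have : #|nbh (K :&: B :\ u)| <= #|nbh K :\: B|.
    rewrite -(cardsID B (nbh _)) h0 cards0 add0n subset_leq_card // setSD // nbhS //.
    by rewrite (subset_trans (subsetDl _ _)) ?subsetIl.
  have := cardsID B K; have := cardsID B (nbh K); rewrite (setIC (nbh K)); move: hK hB; clear; lia.
- apply/negP => wN; move/setP: h0 => /(_ w).
  by rewrite in_setI wN /= in_set0; case/and4P: nB => _ _ ->.
Qed.

(** Neither end of the only edge of [B] is in [K], so the neighbourhood of the trace avoids [B] and
    the strict exchange inequality pushes its surplus below [s]. *)
Lemma near_outside K B u w s : indep K -> #|nbh K| <= #|K| + s ->
  near B u w -> u \in nbh K -> w \notin K -> #|nbh (K :&: B)| < #|K :&: B| + s.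
Proof.
move=> iK hK nB uK wK; have hB := near_exchange iK nB uK.
have uNK : u \notin K.
  by move: iK; rewrite indep_nbh => /pred0P/(_ u)/=; rewrite uK andbT => ->.
have h0 : nbh (K :&: B) :&: B = set0.
  apply/setP => y; rewrite in_setI in_set0; apply/negP => /andP[/nbhP[x] ].
  rewrite inE => /andP[xK xB] exy yB.
  by case: (near_edge nB xB yB exy) => -[E _]; rewrite E ?(negPf uNK) ?(negPf wK) in xK.
have : #|nbh (K :&: B)| <= #|nbh K :\: B|.
  rewrite -(cardsID B (nbh _)) h0 cards0 add0n subset_leq_card // setSD // nbhS //.
  exact: subsetIl.
have := cardsID B K; have := cardsID B (nbh K); rewrite (setIC (nbh K)); move: hK hB; clear; lia.
Qed.

(** [Lg] is an abstract monotone notion of largeness; it is used both for counts of opposed matching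
    edges and for counts of matching edges with an end in [K]. *)
Lemma near_orthogonal K s (Lg : {set T} -> Prop) B1 B2 v w1 w2 :
  indep K -> #|nbh K| <= #|K| + s ->
  (forall J J', J \subset J' -> Lg J -> Lg J') ->
  (forall J, J \subset K -> Lg J -> #|J| + s <= #|nbh J|) ->
  near B1 v w1 -> near B2 v w2 -> w1 != w2 -> (v \in K) || (v \in nbh K) ->
  ~ Lg (K :&: B1 :&: B2 :\: [set v; w1; w2]).
Proof.
move=> iK hK LgS Lgmin n1 n2 w12 vK LgJ.
have LgD J : K :&: B1 :&: B2 :\: [set v; w1; w2] \subset J -> Lg J.
  by move=> sJ; apply: LgS LgJ.
have e1 : e v w1 by case/and3P: n1.
have e2 : e v w2 by case/and3P: n2.
have [v1 v2] : v \in B1 /\ v \in B2 by case/and3P: n1; case/and3P: n2.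
have [wB1 wB2] : w1 \in B1 /\ w2 \in B2 by case/and4P: n1; case/and4P: n2.
set J1 := K :&: B1; set J2 := K :&: B2.
have sJ1 : J1 \subset K by apply: subsetIl.
have sJ2 : J2 \subset K by apply: subsetIl.
case/orP: vK => vK.
  (* Both traces have surplus at most [s]. Their union has surplus at least [s], and their
     intersection at least [s + 1], since [v] brings the two new neighbours [w1] and [w2]. This
     violates submodularity. *)
  have [s1 t1 f1] := near_inside iK hK n1 vK.
  have [s2 t2 f2] := near_inside iK hK n2 vK.
  have vJ : v \in J1 :&: J2 by rewrite !inE vK v1 v2.
  have m1 : #|J1 :|: J2| + s <= #|nbh (J1 :|: J2)|.
    apply: Lgmin; first by rewrite subUset sJ1.
    by apply: LgD; apply/subsetP => x; rewrite !inE => /andP[_ /andP[/andP[-> ->]]].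
  have m2 : #|J1 :&: J2 :\ v| + s <= #|nbh (J1 :&: J2 :\ v)|.
    apply: Lgmin; first by rewrite (subset_trans (subsetDl _ _)) ?(subset_trans (subsetIl _ _)).
    by apply: LgD; apply/subsetP => x; rewrite !inE !negb_or -!andbA => /and5P[-> _ _ -> /andP[-> ->]].
  have m3 : nbh (J1 :&: J2 :\ v) :|: [set w1; w2] \subset nbh (J1 :&: J2).
    rewrite subUset nbhS ?subsetDl //=; apply/subsetP => x; rewrite !inE => /orP[] /eqP->;
    by apply/exists_inP; exists v.
  have := subset_leq_card m3; rewrite cardsU cards2 w12.
  rewrite (_ : _ :&: [set w1; w2] = set0) ?cards0; last first.
    apply/setP => x; rewrite in_set0 in_setI; apply/negP => /andP[xN].
    rewrite !inE => /orP[] /eqP E; move: xN; rewrite E.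
      by apply/negP; apply: contra f1; apply: (subsetP (nbhS _)); rewrite setSD ?subsetIl.
    by apply/negP; apply: contra f2; apply: (subsetP (nbhS _)); rewrite setSD ?subsetIr.
  have := nbh_submod J1 J2; have := cardsUI J1 J2; have := cardsD1 v (J1 :&: J2); rewrite vJ.
  by move: m1 m2 s1 s2; rewrite -/J1 -/J2; clear; lia.
(* Now [v] is in [nbh K]. If [w1] or [w2] were outside [K], the corresponding trace would be large
   with surplus below [s]. *)
case w1K: (w1 \in K); last first.
  have := near_outside iK hK n1 vK (negbT w1K).
  have := Lgmin J1 sJ1 (LgD _ _); rewrite -/J1 => h1; rewrite ltnNge h1 //.
  by apply/subsetP => x; rewrite !inE => /andP[_ /andP[/andP[-> ->]]].
case w2K: (w2 \in K); last first.
  have := near_outside iK hK n2 vK (negbT w2K).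
  have := Lgmin J2 sJ2 (LgD _ _); rewrite -/J2 => h1; rewrite ltnNge h1 //.
  by apply/subsetP => x; rewrite !inE => /andP[_ /andP[/andP[-> _ ->]]].
have [s1 t1 f1] := near_inside iK hK (near_sym n1) w1K.
have [s2 t2 f2] := near_inside iK hK (near_sym n2) w2K.
set J0 := J1 :\ w1.
have sJ0 : J0 \subset K by rewrite (subset_trans (subsetDl _ _)).
have w1J : w1 \in J1 by rewrite inE w1K.
have w1B2 : w1 \notin B2.
  apply/negP => wB; case: (near_edge n2 v2 wB e1) => -[] E1 E2.
    by rewrite E2 eqxx in w12.
  by rewrite E2 e_irr in e1.
have m0 : #|J0| + s <= #|nbh J0|.
  apply: Lgmin => //; apply: LgD; apply/subsetP => x.
  by rewrite !inE !negb_or -!andbA => /and5P[_ -> _ -> /andP[-> _]].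
have mU : #|J1 :|: J2| + s <= #|nbh (J1 :|: J2)|.
  apply: Lgmin; first by rewrite subUset sJ1.
  by apply: LgD; apply/subsetP => x; rewrite !inE => /andP[_ /andP[/andP[-> ->]]].
have mI : #|J0 :&: J2| + s <= #|nbh (J0 :&: J2)|.
  apply: Lgmin; first by rewrite (subset_trans (subsetIl _ _)).
  apply: LgD; apply/subsetP => x.
  by rewrite !inE !negb_or -!andbA => /and5P[_ -> _ -> /andP[-> ->]].
(* Dropping [w1] from [J1] loses only the neighbour [v], which [w2] in [J2] supplies again. So
   [J0 :|: J2] has the neighbourhood of [J1 :|: J2] with one vertex less, and submodularity fails by
   one. *)
have vN : nbh J1 = v |: nbh J0.
  apply/eqP; rewrite eq_sym eqEcard; apply/andP; split.
    rewrite subUset nbhS ?subsetDl // andbT sub1set.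
    by apply/nbhP; exists w1; rewrite // e_sym.
  rewrite cardsU1 f1; move: s1 m0; rewrite -/J1 /J0 [#|J1|](cardsD1 w1) w1J; clear; lia.
have mE : nbh (J1 :|: J2) \subset nbh (J0 :|: J2).
  rewrite !nbhU subUset subsetUr andbT vN subUset subsetUl andbT sub1set.
  rewrite inE; apply/orP; right; apply/nbhP; exists w2; last by rewrite e_sym.
  by rewrite inE w2K.
have := subset_leq_card mE; have := nbh_submod J0 J2; have := cardsUI J1 J2.
have -> : J1 :&: J2 = J0 :&: J2.
  apply/setP => x; rewrite !inE; case: eqP => // -> /=.
  by rewrite (negPf w1B2) !andbF.
have := cardsUI J0 J2; have := cardsD1 w1 J1; rewrite w1J -/J0 -/J1.
by move: m0 mU mI t1 s2; rewrite -/J0 -/J1 -/J2; clear; lia.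
Qed.

End Graph.

(** * Matching edges on which two sets take opposite sides *)

Section Opposite.
Variables (T : finType) (P : {set T}).
Implicit Types (f g : T -> T) (X Y B : {set T}).

(* With [f] and [g] the two ends of a matching indexed by [P], these are the
   matching edges on which [X] and [Y] take opposite sides. *)
Definition opposed f g X Y := [set p in P | (f p \in X) && (g p \in Y)].

Lemma opposedC f g X Y : opposed f g X Y = opposed g f Y X.
Proof. by apply/setP => p; rewrite !inE [(g p \in Y) && _]andbC. Qed.

Lemma opposedS f g X X' Y : X \subset X' -> opposed f g X Y \subset opposed f g X' Y.
Proof.
by move=> /subsetP s; apply/subsetP => p; rewrite !inE => /and3P[-> /s pX ->]; rewrite pX.
Qed.

Lemma opposedI f g X X' Y : opposed f g (X :&: X') Y = opposed f g X Y :&: opposed f g X' Y.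
Proof.
apply/setP => p; rewrite !inE.
by case: (p \in P); case: (f p \in X); case: (f p \in X'); case: (g p \in Y).
Qed.

Lemma card_opposed f g X Y : {in P &, injective f} -> #|opposed f g X Y| <= #|X|.
Proof.
move=> fI; have <- : #|f @: opposed f g X Y| = #|opposed f g X Y|.
  by apply: card_in_imset => p r; rewrite !inE => /andP[pP _] /andP[rP _]; apply: fI.
by apply: subset_leq_card; apply/subsetP => _ /imsetP[p pO ->]; move: pO; rewrite inE => /and3P[].
Qed.

Lemma card_opposedD f g X Y Z : {in P &, injective f} ->
  #|opposed f g X Y| <= #|opposed f g (X :\: Z) Y| + #|Z|.
Proof.
move=> fI; rewrite -(cardsID (opposed f g Z Y)) addnC leq_add //.
  apply: subset_leq_card; apply/subsetP => p; rewrite !inE.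
  by case: (p \in P); case: (f p \in Z); case: (f p \in X); case: (g p \in Y).
apply: leq_trans (subset_leq_card (subsetIr _ _)) _; exact: card_opposed.
Qed.

End Opposite.

(** Inclusion-exclusion without the triple intersection. *)
Lemma card3_pairwise (T : finType) (R X Y Z : {set T}) :
  X \subset R -> Y \subset R -> Z \subset R ->
  #|X| + #|Y| + #|Z| <= #|R| + #|X :&: Y| + #|X :&: Z| + #|Y :&: Z|.
Proof.
move=> sX sY sZ.
have := subset_leq_card (_ : X :|: Y :|: Z \subset R); rewrite !subUset sX sY sZ => /(_ isT).
have := cardsUI X Y; have := cardsUI (X :|: Y) Z.
have := cardsUI (X :&: Z) (Y :&: Z); rewrite -setIUl; clear; lia.
Qed.

(** * Critical sets against a pair of opposite sets *)

Section Region.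
Variables (T : finType) (e : rel T).
Hypotheses (e_sym : symmetric e) (e_irr : irreflexive e).
Variable a : nat.
Hypothesis alpha_max : forall A, indep e A -> #|A| <= a.
Hypothesis critical : forall u w, e u w -> exists B, near e a B u w.
Local Notation near := (near e a).
Local Notation indep := (indep e).
Local Notation nbh := (nbh e).
Implicit Types (B J : {set T}) (u v w x y : T).

(** For another edge [uy], take a critical set [B]: it omits [w], and replacing [u] by the leaf [w]
    gives an independent set with [a + 1] vertices. *)
Lemma near_leaf u w : e w u -> (forall y, e w y -> y = u) -> forall y, e u y -> y = w.
Proof.
move=> ewu leaf y euy; apply/eqP/negPn/negP => yw.
have [B nB] := critical euy.
case/and5P: (nB) => _ uB yB iu /andP[_ /eqP cB].
have uw : u != w by apply: contraTneq ewu => ->; rewrite e_irr.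
have wB : w \notin B.
  apply/negP => wB; case: (near_edge e_irr nB uB wB _); first by rewrite e_sym.
    by case=> _ E; rewrite E eqxx in yw.
  by case=> _ E; rewrite E eqxx in uw.
have : indep (w |: (B :\ u)).
  apply: indepU => //; first exact: indep1.
  apply/pred0P => z /=; rewrite in_set1; apply/negP => /andP[/eqP-> /nbhP[t]].
  by rewrite !inE e_sym => /andP[tu _] /leaf E; rewrite E eqxx in tu.
by move/alpha_max; rewrite cardsU1 !inE (negPf wB) andbF; have := cardsD1 u B; rewrite uB cB; clear; lia.
Qed.

Lemma near_swap B u w x z : near B u w -> e w x -> x \notin B -> e x z -> z \in B ->
  z != w -> (forall y, e x y -> y \in B -> y = w \/ y = z) -> near (x |: (B :\ w)) x z.
Proof.
move=> nB ewx xB exz zB zw xN.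
case/and5P: (nB) => _ uB wB iu /andP[iw /eqP cB].
have xw : x != w by apply: contraTneq ewx => ->; rewrite e_irr.
have xz : z != x by apply: contraTneq exz => ->; rewrite e_irr.
apply/and5P; split => //; rewrite ?inE ?eqxx ?zw ?zB ?orbT //; last (apply/andP; split).
- by apply: indepS iw; apply/subsetP => y; rewrite !inE => /andP[/negPf->].
- have -> : (x |: B :\ w) :\ z = x |: (B :\ w :\ z).
    by apply/setP => y; rewrite !inE; case: (y =P x) => [->|_] //=; rewrite ?andbT // eq_sym xz.
  apply: indepU => //; [exact: indep1 | by apply: indepS iw; apply: subsetDl |].
  apply/pred0P => y /=; rewrite in_set1; apply/negP => /andP[/eqP-> /nbhP[t]].
  rewrite !inE e_sym => /and3P[tz tw tB] ext.
  by case: (xN t ext tB) => E; rewrite E eqxx ?andbF in tz tw.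
- by rewrite cardsU1 !inE (negPf xB) andbF; have := cardsD1 w B; rewrite wB cB; clear; lia.
Qed.

Variables (P : {set T}) (f g : T -> T) (D L : nat).
Hypotheses (f_inj : {in P &, injective f}) (g_inj : {in P &, injective g}).
Hypothesis missed : forall B u w, near B u w ->
  #|[set p in P | (f p \notin B) && (g p \notin B)]| <= D.
Hypothesis base : forall J, indep J -> L <= #|J| -> #|J| + 2 <= #|nbh J|.

Local Notation opp := (opposed P f g).

(** Apart from [D] exceptions, [B] contains an end of each opposed edge, hence catches it on the [K]
    side or on the [M] side. *)
Lemma opp_cover K M B u w : near B u w ->
  #|opp K M| <= #|opp (K :&: B) M| + #|opp K (M :&: B)| + D.
Proof.
move=> nB; rewrite -addnA; apply: leq_trans (leq_add (leqnn _) (leq_add (leqnn _) (missed nB))).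
apply: leq_trans (leq_add (leqnn _) (leq_card_setU _ _)); apply: leq_trans (leq_card_setU _ _).
apply: subset_leq_card; apply/subsetP => p; rewrite !inE.
by case: (p \in P); case: (f p \in B); case: (g p \in B); case: (f p \in K); case: (g p \in M).
Qed.

(** Discarding [v], [w1], [w2] costs at most three opposed edges, so [L + 3] common ones would leave
    a large common trace. *)
Lemma opp_orthogonal K M s B1 B2 v w1 w2 : indep K -> #|nbh K| <= #|K| + s ->
  (forall J, J \subset K -> L <= #|opp J M| -> #|J| + s <= #|nbh J|) ->
  near B1 v w1 -> near B2 v w2 -> w1 != w2 -> (v \in K) || (v \in nbh K) ->
  #|opp (K :&: B1) M :&: opp (K :&: B2) M| <= L + 2.
Proof.
move=> iK hK mK n1 n2 w12 vK; rewrite leqNgt; apply/negP => h.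
apply: (near_orthogonal e_sym e_irr alpha_max iK hK _ mK n1 n2 w12 vK).
  by move=> J J' sJ h1; apply: leq_trans h1 (subset_leq_card (opposedS _ _ _ _ sJ)).
have := card_opposedD g (K :&: B1 :&: B2) M [set v; w1; w2] f_inj.
have : #|[set v; w1; w2]| <= 3.
  by rewrite setUC cardsU1 cards2; case: (_ \notin _); case: (_ != _).
have -> : opp (K :&: B1 :&: B2) M = opp (K :&: B1) M :&: opp (K :&: B2) M.
  by rewrite -opposedI; congr opp; apply/setP => p; rewrite !inE; case: (p \in K).
by move: h; clear; lia.
Qed.

Lemma opp_outside K M s B u w : indep K -> #|nbh K| <= #|K| + s ->
  (forall J, J \subset K -> L <= #|opp J M| -> #|J| + s <= #|nbh J|) ->
  near B u w -> u \in nbh K -> w \notin K -> #|opp (K :&: B) M| < L.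
Proof.
move=> iK hK mK nB uK wK; rewrite ltnNge; apply/negP => /(mK _ (subsetIl _ _)).
by have := near_outside e_sym e_irr alpha_max iK hK nB uK wK; rewrite ltnNge => /negPf->.
Qed.
End Region.

(** * The region where two opposite sets meet *)

Section Walk.
Variables (T : finType) (e : rel T).
Hypotheses (e_sym : symmetric e) (e_irr : irreflexive e).
Variable a : nat.
Hypothesis alpha_max : forall A, indep e A -> #|A| <= a.
Hypothesis critical : forall u w, e u w -> exists B, near e a B u w.
Local Notation near := (near e a).
Local Notation indep := (indep e).
Local Notation nbh := (nbh e).
Implicit Types (B J : {set T}) (u v w x y : T).
Variables (P : {set T}) (f g : T -> T) (D L : nat).
Hypotheses (f_inj : {in P &, injective f}) (g_inj : {in P &, injective g}).
Hypothesis missed : forall B u w, near B u w ->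
  #|[set p in P | (f p \notin B) && (g p \notin B)]| <= D.
Hypothesis base : forall J, indep J -> L <= #|J| -> #|J| + 2 <= #|nbh J|.
Local Notation opp := (opposed P f g).

Variables (K M : {set T}) (s t : nat).
Hypotheses (iK : indep K) (iM : indep M).
Hypotheses (hK : #|nbh K| <= #|K| + s) (hM : #|nbh M| <= #|M| + t).
Hypothesis mK : forall J, J \subset K -> L <= #|opp J M| -> #|J| + s <= #|nbh J|.
Hypothesis mM : forall J, J \subset M -> L <= #|opp K J| -> #|J| + t <= #|nbh J|.
Hypothesis large : 6 * L + 3 * D + 13 <= #|opp K M|.

Let mM' J : J \subset M -> L <= #|opposed P g f J K| -> #|J| + t <= #|nbh J|.
Proof. by rewrite opposedC; apply: mM. Qed.

Let orthK B1 B2 v w1 w2 : near B1 v w1 -> near B2 v w2 -> w1 != w2 ->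
  (v \in K) || (v \in nbh K) -> #|opp (K :&: B1) M :&: opp (K :&: B2) M| <= L + 2.
Proof. exact: (opp_orthogonal e_sym e_irr alpha_max f_inj iK hK mK). Qed.

Let orthM B1 B2 v w1 w2 : near B1 v w1 -> near B2 v w2 -> w1 != w2 ->
  (v \in M) || (v \in nbh M) -> #|opp K (M :&: B1) :&: opp K (M :&: B2)| <= L + 2.
Proof. by rewrite ![opp _ _]opposedC; exact: (opp_orthogonal e_sym e_irr alpha_max g_inj iM hM mM'). Qed.

Let outK B u w : near B u w -> u \in nbh K -> w \notin K -> #|opp (K :&: B) M| < L.
Proof. exact: (opp_outside e_sym e_irr alpha_max iK hK mK). Qed.

Let outM B u w : near B u w -> u \in nbh M -> w \notin M -> #|opp K (M :&: B)| < L.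
Proof. by rewrite opposedC; exact: (opp_outside e_sym e_irr alpha_max iM hM mM'). Qed.

Let cover B u w : near B u w ->
  #|opp K M| <= #|opp (K :&: B) M| + #|opp K (M :&: B)| + D.
Proof. exact: opp_cover. Qed.

Let subK B : opp (K :&: B) M \subset opp K M.
Proof. by apply: opposedS; apply: subsetIl. Qed.

Let subM B : opp K (M :&: B) \subset opp K M.
Proof. by rewrite opposedC [opp K M]opposedC; apply: opposedS; apply: subsetIl. Qed.

(** With [N] opposed edges in all, covering by three critical sets gives total trace at least
    [3N - 3D]. Pairwise orthogonality bounds it by [N + 3(L + 2)] on each side, so [N] is at most
    [6L + 3D + 12], just below [large]. *)
Lemma region_deg2 v w1 w2 w3 : (v \in K) || (v \in nbh K) -> (v \in M) || (v \in nbh M) ->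
  e v w1 -> e v w2 -> e v w3 -> w1 != w2 -> w1 != w3 -> w2 != w3 -> False.
Proof.
move=> vK vM /critical[B1 n1] /critical[B2 n2] /critical[B3 n3] w12 w13 w23.
have := card3_pairwise (subK B1) (subK B2) (subK B3).
have := card3_pairwise (subM B1) (subM B2) (subM B3).
have := cover n1; have := cover n2; have := cover n3.
have := orthK n1 n2 w12 vK; have := orthK n1 n3 w13 vK; have := orthK n2 n3 w23 vK.
have := orthM n1 n2 w12 vM; have := orthM n1 n3 w13 vM; have := orthM n2 n3 w23 vM.
move: large; clear; lia.
Qed.

(** The vertex [z] has degree at most two and its neighbour [x] is already counted. *)
Lemma region_new_nbr J x z : x \in nbh J -> e x z -> z \in K -> z \in nbh M ->
  #|nbh (z |: J)| <= #|nbh J|.+1.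
Proof.
move=> xJ exz zK zM; rewrite nbhU setUC -(cardsID (nbh J) (_ :|: _)) -addn1 leq_add //.
  by rewrite subset_leq_card ?subsetIr.
apply/card_le1_eqP => y1 y2; rewrite in_setD in_setU => /andP[/negPf y1J]; rewrite y1J /= => /nbhP[t1 /set1P-> e1].
rewrite in_setD in_setU => /andP[/negPf y2J]; rewrite y2J /= => /nbhP[t2 /set1P-> e2].
apply/eqP/negPn/negP => y12.
have zx : e z x by rewrite e_sym.
apply: (@region_deg2 z x y1 y2) => //; rewrite ?zK ?zM ?orbT //.
  by apply: contraFneq y1J => <-.
  by apply: contraFneq y2J => <-.
by rewrite eq_sym.
Qed.

(* Moving along a path of degree-two vertices, a near-independent set for one of
   its edges is turned into one for the edge after the next by exchanging a
   single vertex; [J] collects the vertices of [K] already passed. *)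
Lemma region_walk n B u w x J : L <= n + #|J| -> near B u w -> w \in K -> w \in nbh M ->
  J \subset K -> w \in J -> #|nbh J| <= #|J|.+1 -> J :&: B = [set w] ->
  #|opp K (M :&: B)| <= L + #|J| -> e w x -> x != u -> False.
Proof.
elim: n B u w x J => [|n IH] B u w x J hn nB wK wM JK wJ nJ JB hB ewx xu.
  by have := base (indepS JK iK) hn; move: nJ; clear; lia.
have [hL|hL] := leqP L #|J|.
  by have := base (indepS JK iK) hL; move: nJ; clear; lia.
case/and5P: (nB) => euw uB wB iu /andP[iw /eqP cB].
have xB : x \notin B.
  apply/negP => xB; case: (near_edge e_irr nB wB xB ewx) => -[E1 E2].
    by rewrite E1 e_irr in euw.
  by rewrite E2 eqxx in xu.
have xK : x \in nbh K by apply/nbhP; exists w.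
have xJ : x \in nbh J by apply/nbhP; exists w.
have cov := cover nB.
(* If [x] is outside [M], then [B] and the critical set of [wx] both have small traces on the [M]
   side, hence nearly full ones on the [K] side, against orthogonality at [w]. *)
case xM: (x \in M); last first.
  have [B' nB'] := critical ewx.
  have h1 := outM nB' wM (negbT xM).
  have ux : u != x by rewrite eq_sym.
  have := orthK (near_sym e_sym nB) nB' ux; rewrite wK => /(_ isT) h2.
  have := cardsUI (opp (K :&: B) M) (opp (K :&: B') M).
  have : #|opp (K :&: B) M :|: opp (K :&: B') M| <= #|opp K M|.
    by rewrite subset_leq_card // subUset !subK.
  have := cover nB'; move: large cov hL hB h1 h2; clear; lia.
have wx : w != x by apply: contraTneq ewx => ->; rewrite e_irr.
(* Otherwise exchanging [w] for [x] in [B] would give an independent set with [a + 1] vertices. *)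
have [z [zB zw exz]] : exists z, [/\ z \in B, z != w & e x z].
  case: (pickP (fun z => [&& z \in B, z != w & e x z])) => [z /and3P[]|no]; first by exists z.
  have : indep (x |: (B :\ w)).
    apply: indepU => //; first exact: indep1.
    apply/pred0P => y /=; rewrite in_set1; apply/negP => /andP[/eqP-> /nbhP[y']].
    by rewrite !inE e_sym => /andP[yw yB] exy; have := no y'; rewrite yw yB exy.
  move/alpha_max; rewrite cardsU1 !inE (negPf xB) andbF.
  by have := cardsD1 w B; rewrite wB cB; clear; lia.
have exw : e x w by rewrite e_sym.
have n2 : near (x |: (B :\ w)) x z.
  apply: (near_swap e_sym e_irr nB ewx xB exz zB zw) => // y exy yB.
  case: (y =P w) => [|/eqP yw]; first by left.
  case: (y =P z) => [|/eqP yz]; first by right.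
  case: (@region_deg2 x w z y) => //; rewrite ?xK ?xM ?orbT //; by rewrite eq_sym.
have hB2 : #|opp K (M :&: (x |: B :\ w))| <= (L + #|J|).+1.
  rewrite -addn1; apply: leq_trans (leq_add hB (_ : #|[set p in P | g p == x]| <= 1)).
    apply: leq_trans (leq_card_setU _ _); apply: subset_leq_card.
    apply/subsetP => p; rewrite !inE.
    case: (p \in P); case: (f p \in K); case: (g p \in M); case: (g p == x); case: (g p \in B) => //=;
      by rewrite ?orbT ?andbF.
  apply/card_le1_eqP => p r; rewrite !inE => /andP[pP /eqP gp] /andP[rP /eqP gr].
  by apply: g_inj; rewrite ?gp.
have cov2 := cover n2.
(* If [z] is outside [K], the new critical set has small traces on both sides, which contradicts
   covering. *)
case zK: (z \in K); last first.
  have := outK n2 xK (negbT zK); move: large cov2 hL hB2; clear; lia.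
have zM : z \in nbh M by apply/nbhP; exists x.
have zJ : z \notin J.
  apply/negP => zJ; move/setP: JB => /(_ z); rewrite in_setI zJ zB in_set1.
  by rewrite (negPf zw).
(* If [z] were a leaf at [x], then [x] could not have the second neighbour [w]. *)
have [y ezy yx] : exists2 y, e z y & y != x.
  case: (pickP (fun y => e z y && (y != x))) => [y /andP[]|no]; first by exists y.
  have ezx : e z x by rewrite e_sym.
  have leaf y : e z y -> y = x by move=> ezy; have := no y; rewrite ezy /= => /negbT/negPn/eqP.
  by have := near_leaf e_sym e_irr alpha_max critical ezx leaf exw => E; rewrite E eqxx in zw.
apply: (IH (x |: B :\ w) x z y (z |: J)) => //.
- by rewrite cardsU1 zJ; move: hn; clear; lia.
- by rewrite subUset sub1set zK.
- by rewrite !inE eqxx.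
- apply: leq_trans (region_new_nbr xJ exz zK zM) _; rewrite cardsU1 zJ; exact: nJ.
- have xNK : x \notin K.
    by move: iK; rewrite indep_nbh => /pred0P/(_ x)/=; rewrite xK andbT => ->.
  apply/setP => y'; rewrite !inE; case: (y' =P z) => [->|y'z] /=; first by rewrite zw zB orbT.
  case y'J: (y' \in J) => //=; have y'K := subsetP JK _ y'J.
  have -> : (y' == x) = false by apply: contraNF xNK => /eqP<-.
  by move/setP: JB => /(_ y'); rewrite !inE y'J /= => ->; case: eqP.
- by rewrite cardsU1 zJ; move: hB2; clear; lia.
Qed.

(** If [u] is outside [M], the critical set of [wu] has a small trace on the [M] side. A walk then
    starts at [w] with [J = [set w]], away from [u], towards a neighbour of [w] in [M]. *)
Lemma region_closed w u : w \in K -> w \in nbh M -> e w u -> u \in M.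
Proof.
move=> wK wM ewu; apply/negPn/negP => uM.
have [B nB] := critical ewu.
have [x xM exw] := nbhP _ _ _ wM.
have wB : w \in B by case/and3P: nB.
have ewx : e w x by rewrite e_sym.
have xu : x != u by apply: contraNneq uM => <-.
apply: (@region_walk L B u w x [set w]) => //; rewrite ?leq_addr ?set11 ?sub1set //.
- exact: near_sym.
- rewrite cards1; apply: leq_trans (_ : #|[set u; x]| <= 2); last by rewrite cards2; case: (_ != _).
  apply: subset_leq_card; apply/subsetP => y /nbhP[_ /set1P-> ewy].
  rewrite !inE; apply/negPn/negP; rewrite negb_or => /andP[yu yx].
  apply: (@region_deg2 w u x y) => //; rewrite ?wK ?wM ?orbT //; by rewrite eq_sym.
- by apply/setP => y; rewrite !inE; case: eqP => // ->.
- by apply: leq_trans (leq_addr _ _); apply: ltnW; apply: outM nB wM uM.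
Qed.
End Walk.

(** * Descent on the surplus *)

Section Levels.
Variables (T : finType) (e : rel T).
Hypotheses (e_sym : symmetric e) (e_irr : irreflexive e).
Variable a : nat.
Hypothesis alpha_max : forall A, indep e A -> #|A| <= a.
Hypothesis critical : forall u w, e u w -> exists B, near e a B u w.
Local Notation near := (near e a).
Local Notation indep := (indep e).
Local Notation nbh := (nbh e).
Implicit Types (B J K M : {set T}) (u v w x y : T).
Variables (P : {set T}) (f g : T -> T) (D : nat).
Hypotheses (f_inj : {in P &, injective f}) (g_inj : {in P &, injective g}).
Hypothesis fg_edge : forall p, p \in P -> e (f p) (g p).
Hypothesis missed : forall B u w, near B u w ->
  #|[set p in P | (f p \notin B) && (g p \notin B)]| <= D.
Local Notation opp := (opposed P f g).

(** With many opposed edges, [K :&: nbh M] and [M :&: nbh K] contain each other's neighbourhoods.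
    Both have at least [L] vertices, so [base] would make each larger than the other. *)
Lemma opposed_lt L K M s t :
  (forall J, indep J -> L <= #|J| -> #|J| + 2 <= #|nbh J|) ->
  indep K -> indep M -> #|nbh K| <= #|K| + s -> #|nbh M| <= #|M| + t ->
  (forall J, J \subset K -> L <= #|opp J M| -> #|J| + s <= #|nbh J|) ->
  (forall J, J \subset M -> L <= #|opp K J| -> #|J| + t <= #|nbh J|) ->
  #|opp K M| < 6 * L + 3 * D + 13.
Proof.
move=> base iK iM hK hM mK mM; rewrite ltnNge; apply/negP => large.
have missed' B u w : near B u w -> #|[set p in P | (g p \notin B) && (f p \notin B)]| <= D.
  move/missed; apply: leq_trans; apply: subset_leq_card; apply/subsetP => p.
  by rewrite !inE => /and3P[-> -> ->].
have cK := region_closed e_sym e_irr alpha_max critical f_inj g_inj missed base iK iM hK hM mK mM large.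
have cM : forall w u, w \in M -> w \in nbh K -> e w u -> u \in K.
  apply: (region_closed e_sym e_irr alpha_max critical g_inj f_inj missed' base iM iK hM hK).
  - by move=> J; rewrite opposedC; apply: mM.
  - by move=> J; rewrite opposedC; apply: mK.
  - by rewrite opposedC.
have hL : L <= #|opp K M| by move: large; clear; lia.
have sub : opp K M \subset opp (K :&: nbh M) (M :&: nbh K).
  apply/subsetP => p; rewrite !in_set => /and3P[pP fK gM]; rewrite pP fK gM /=.
  by apply/andP; split; [apply/exists_inP; exists (g p); rewrite // e_sym | apply/exists_inP; exists (f p)]; rewrite ?fg_edge.
have lK : L <= #|K :&: nbh M|.
  by apply: leq_trans (leq_trans hL (subset_leq_card sub)) _; apply: card_opposed.
have lM : L <= #|M :&: nbh K|.
  by apply: leq_trans (leq_trans hL (subset_leq_card sub)) _; rewrite opposedC; apply: card_opposed.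
have := base _ (indepS (subsetIl _ _) iK) lK; have := base _ (indepS (subsetIl _ _) iM) lM.
have : #|nbh (K :&: nbh M)| <= #|M :&: nbh K|.
  apply: subset_leq_card; apply/subsetP => y /nbhP[x]; rewrite in_setI => /andP[xK xM] exy.
  by rewrite in_setI (cK x) //=; apply/nbhP; exists x.
have : #|nbh (M :&: nbh K)| <= #|K :&: nbh M|.
  apply: subset_leq_card; apply/subsetP => y /nbhP[x]; rewrite in_setI => /andP[xM xK] exy.
  by rewrite in_setI (cM x) //=; apply/nbhP; exists x.
clear; lia.
Qed.

Variables (l h : nat).
Hypothesis h_gt0 : 0 < h.
Hypothesis base : forall J, indep J -> l < #|J| -> #|J| + h < #|nbh J|.

(** Here [t] bounds the sum of the excesses of two surpluses over [h]; the recursion is the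
    threshold of [opposed_lt]. *)
Fixpoint pair_bound t := if t is t'.+1 then 6 * pair_bound t' + 3 * D + 13 else l.+1.

Lemma pair_bound_gt t : l < pair_bound t.
Proof. by elim: t => [|t IH] //=; move: IH; clear; lia. Qed.

(** A large subset of [K] or [M] with smaller surplus would contradict the previous level; without
    one, the minimality hypotheses of [opposed_lt] hold. *)
Lemma opposed_level t K M i j : indep K -> indep M ->
  #|nbh K| <= #|K| + (h + i) -> #|nbh M| <= #|M| + (h + j) -> i + j <= t ->
  #|opp K M| < pair_bound t.
Proof.
elim: t K M i j => [|t IH] K M i j iK iM hK hM ij.
  rewrite ltnNge; apply/negP => /leq_trans/(_ (card_opposed _ _ _ f_inj))/(base iK).
  by move: hK ij; clear; lia.
have bK J X : pair_bound t <= #|opp J X| -> l < #|J|.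
  move=> hJ; apply: leq_trans (card_opposed g J X f_inj); apply: leq_trans hJ; exact: pair_bound_gt.
have bM J X : pair_bound t <= #|opp X J| -> l < #|J|.
  rewrite opposedC => hJ; apply: leq_trans (card_opposed f J X g_inj); apply: leq_trans hJ; exact: pair_bound_gt.
apply: (opposed_lt _ iK iM hK hM).
- move=> J iJ hJ; have := base iJ (leq_trans (pair_bound_gt t) hJ).
  by move: h_gt0; clear; lia.
- move=> J JK hJ; have iJ := indepS JK iK; rewrite leqNgt; apply/negP => lt.
  have := base iJ (bK _ _ hJ) => b.
  suff : #|opp J M| < pair_bound t by rewrite ltnNge hJ.
  by apply: (IH J M i.-1 j) => //; move: lt b ij; clear; lia.
- move=> J JM hJ; have iJ := indepS JM iM; rewrite leqNgt; apply/negP => lt.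
  have := base iJ (bM _ _ hJ) => b.
  suff : #|opp K J| < pair_bound t by rewrite ltnNge hJ.
  by apply: (IH K J i j.-1) => //; move: lt b ij; clear; lia.
Qed.

Variable r : nat.
Hypothesis top : forall A, indep A -> #|A| = a -> #|nbh A| <= #|A| + (h + r).

(** If every vertex of [K] had at most one neighbour, choosing a neighbour in [K] would inject
    [nbh K] into [K]. *)
Lemma two_nbrs K : #|K| < #|nbh K| ->
  exists v w1 w2, [/\ v \in K, e v w1, e v w2 & w1 != w2].
Proof.
move=> lt; case: (boolP [exists v in K, exists w1, exists w2, [&& e v w1, e v w2 & w1 != w2]]).
  by case/exists_inP => v vK /existsP[w1 /existsP[w2 /and3P[]]]; exists v, w1, w2.
move/exists_inPn => no; pose c y := odflt y [pick x in K | e x y].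
have cP y : y \in nbh K -> c y \in K /\ e (c y) y.
  rewrite /c; case: pickP => [x /andP[]|none] //= /nbhP[x xK exy].
  by have := none x; rewrite xK exy.
move: lt; rewrite ltnNge; case/negP.
have <- : #|c @: nbh K| = #|nbh K|.
  apply: card_in_imset => y z /cP[yK ey] /cP[zK ez] E; apply/eqP/negPn/negP => yz.
  have /existsPn/(_ y)/existsPn/(_ z) := no _ yK.
  by rewrite ey E ez yz.
by apply: subset_leq_card; apply/subsetP => _ /imsetP[y /cP[yK _] ->].
Qed.

Let fib (X : {set T}) := [set p in P | f p \in X].

(** Take two edges at some [v] in [K]. Removing [v] from either critical set leaves a maximum
    independent set, which by [opposed_level] is opposite to [K] on few edges. So each critical set
    loses at most [D + pair_bound (r + r)] of [fib K]. With three vertices discarded, the common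
    trace exceeds the bound of the level below, against orthogonality. *)
Lemma fiber_level i K : i <= r -> indep K -> #|nbh K| <= #|K| + (h + i) ->
  #|fib K| <= l + i * (2 * D + 2 * pair_bound (r + r) + 3).
Proof.
have card_fib X : #|fib X| <= #|X|.
  have <- : #|f @: fib X| = #|fib X|.
    by apply: card_in_imset => p s; rewrite !inE => /andP[pP _] /andP[rP _]; apply: f_inj.
  apply: subset_leq_card; apply/subsetP => _ /imsetP[p pO ->].
  by move: pO; rewrite inE => /andP[].
elim: i K => [|i IH] K ir iK hK; rewrite leqNgt; apply/negP => lt.
  by have := base iK (leq_trans _ (card_fib K)); move: lt hK; rewrite mul0n !addn0 => ->; clear; lia.
have lK : l < #|K|.
  by apply: leq_trans (card_fib K); apply: leq_trans lt; rewrite ltnS leq_addr.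
have [v [w1 [w2 [vK e1 e2 w12]]]] : exists v w1 w2, [/\ v \in K, e v w1, e v w2 & w1 != w2].
  by apply: two_nbrs; have := base iK lK; clear; lia.
have [B1 n1] := critical e1; have [B2 n2] := critical e2.
set C := 2 * D + _ + 3 in IH lt *.
have mis B w : near B v w -> #|fib K :\: fib B| < D + pair_bound (r + r) + 1.
  move=> nB; case/and5P: (nB) => _ vB _ iB /andP[_ /eqP cB].
  have cA : #|B :\ v| = a by have := cardsD1 v B; rewrite vB cB; clear; lia.
  have hA := opposed_level iK iB hK (top iB cA) (leq_add ir (leqnn r)).
  have hD : #|opp K B| <= #|opp K (B :\ v)| + 1.
    by rewrite ![opp K _]opposedC -(cards1 v); apply: card_opposedD.
  have : #|fib K :\: fib B| <= #|[set p in P | (f p \notin B) && (g p \notin B)]| + #|opp K B|.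
    apply: leq_trans (leq_card_setU _ _); apply: subset_leq_card; apply/subsetP => p.
    rewrite !inE; by case: (p \in P); case: (f p \in B); case: (g p \in B); case: (f p \in K).
  by have := missed nB; move: hA hD; clear; lia.
apply: (near_orthogonal e_sym e_irr alpha_max (Lg := fun J => l + i * C < #|fib J|) iK hK _ _ n1 n2 w12).
- move=> J J' sJ h1; apply: leq_trans h1 (subset_leq_card _).
  by apply/subsetP => p; rewrite !inE => /andP[-> /(subsetP sJ)].
- move=> J JK lJ; rewrite leqNgt; apply/negP => lt'.
  suff : #|fib J| <= l + i * C by rewrite leqNgt lJ.
  by apply: IH (ltnW ir) (indepS JK iK) _; move: lt'; clear; lia.
- by rewrite vK.
have h3 : #|[set v; w1; w2]| <= 3.
  by rewrite setUC cardsU1 cards2; case: (_ \notin _); case: (_ != _).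
set S := K :&: B1 :&: B2 :\: _.
have : #|fib K| <= #|fib S| + #|fib K :\: fib B1| + #|fib K :\: fib B2| + #|fib [set v; w1; w2]|.
  apply: leq_trans (_ : #|fib S :|: fib K :\: fib B1 :|: fib K :\: fib B2 :|: fib [set v; w1; w2]| <= _); last first.
    by do 3! (apply: leq_trans (leq_card_setU _ _) _; apply: leq_add => //).
  apply: subset_leq_card; apply/subsetP => p; rewrite !inE.
  case: (p \in P); case: (f p \in K); case: (f p \in B1); case: (f p \in B2) => //=;
    by case: (f p == v); case: (f p == w1); case: (f p == w2).
have := mis _ _ n1; have := mis _ _ n2; have := card_fib [set v; w1; w2].
by move: h3 lt; rewrite mulSn /C; clear; lia.
Qed.

End Levels.

(** * Matchings and the lower bound on the surplus *)

(** Induction on [#|J|]. A tight nonempty proper subset is matched first, and Hall's condition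
    survives for the rest; if there is none, every such subset has a spare neighbour and one pair
    can be fixed arbitrarily. *)
Lemma hall_marriage (T : finType) (F : T -> {set T}) (J : {set T}) :
  (forall X : {set T}, X \subset J -> #|X| <= #|\bigcup_(x in X) F x|) ->
  exists mu : T -> T, {in J &, injective mu} /\ {in J, forall x, mu x \in F x}.
Proof.
have [n] := ubnP #|J|; elim: n F J => // n IH F J; rewrite ltnS => Jn hallJ.
have [->|[x0 x0J]] := set_0Vmem J.
  by exists id; split => x; rewrite in_set0.
case: (boolP [exists X : {set T}, [&& X \proper J, X != set0 & #|\bigcup_(x in X) F x| <= #|X|]]).
  case/existsP => X /and3P[XJ X0 FX].
  have sXJ := proper_sub XJ.
  have [||mu1 [inj1 in1]] := IH F X.
  - exact: leq_trans (proper_card XJ) Jn.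
  - by move=> Y YX; apply: hallJ; apply: subset_trans YX sXJ.
  pose G x := F x :\: \bigcup_(z in X) F z.
  have [||mu2 [inj2 in2]] := IH G (J :\: X).
  - apply: leq_trans Jn; apply: proper_card; rewrite properEneq subsetDl andbT.
    have [x xX] := set0Pn _ X0; apply/eqP => /setP/(_ x).
    by rewrite !inE xX (subsetP sXJ).
  - move=> Y YJ; have -> : \bigcup_(x in Y) G x = \bigcup_(x in Y) F x :\: \bigcup_(z in X) F z.
      apply/setP => y; rewrite in_setD; apply/bigcupP/andP => [[x xY]|[yX /bigcupP[x xY yF]]].
        by rewrite in_setD => /andP[-> yF]; split=> //; apply/bigcupP; exists x.
      by exists x; rewrite // in_setD yX.
    have XY0 : X :&: Y = set0.
      apply/setP => x; rewrite !inE; apply/negP => /andP[xX /(subsetP YJ)].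
      by rewrite inE xX.
    have := hallJ (X :|: Y); rewrite subUset sXJ (subset_trans YJ (subsetDl _ _)) => /(_ isT).
    rewrite bigcup_setU cardsU XY0 cards0 cardsU.
    have := cardsID (\bigcup_(z in X) F z) (\bigcup_(x in Y) F x).
    rewrite [_ :&: \bigcup_(z in X) F z]setIC; move: FX; clear; lia.
  exists (fun x => if x \in X then mu1 x else mu2 x); split=> [x y xJ yJ|x xJ].
    have aux z t : z \in X -> t \in J -> t \notin X -> mu1 z <> mu2 t.
      move=> zX tJ tX E; have := in2 t; rewrite !inE tX tJ => /(_ isT)/andP[/negP[]].
      by rewrite -E; apply/bigcupP; exists z => //; apply: in1.
    case: ifPn => xX; case: ifPn => yX.
    - exact: inj1.
    - by move/aux; move/(_ xX yJ yX).
    - by move/esym/aux; move/(_ yX xJ xX).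
    - by apply: inj2; rewrite inE ?xX ?yX.
  case: ifPn => xX; first exact: in1.
  by have := in2 x; rewrite inE xX xJ => /(_ isT); rewrite inE => /andP[].
move/existsPn => tight.
have [y0 y0F] : exists y, y \in F x0.
  apply/set0Pn; rewrite -card_gt0; have := hallJ [set x0].
  by rewrite sub1set x0J cards1 big_set1 => /(_ isT).
have [||mu [injm inm]] := IH (fun x => F x :\ y0) (J :\ x0).
- by apply: leq_trans Jn; rewrite (cardsD1 x0 J) x0J.
- move=> Y YJ; have [->|Y0] := eqVneq Y set0; first by rewrite cards0.
  have YJ' : Y \proper J.
    apply: sub_proper_trans YJ _; rewrite properEneq subsetDl andbT.
    by apply/eqP => /setP/(_ x0); rewrite !inE eqxx x0J.
  have := tight Y; rewrite YJ' Y0 /= -ltnNge => lt.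
  have : \bigcup_(x in Y) F x :\ y0 \subset \bigcup_(x in Y) (F x :\ y0).
    apply/subsetP => y; rewrite in_setD1 => /andP[yy0 /bigcupP[x xY yF]].
    by apply/bigcupP; exists x; rewrite // in_setD1 yy0.
  move/subset_leq_card; have := cardsD1 y0 (\bigcup_(x in Y) F x); move: lt; clear; lia.
exists (fun x => if x == x0 then y0 else mu x); split=> [x y xJ yJ|x xJ].
  have aux z : z \in J -> z != x0 -> y0 <> mu z.
    by move=> zJ zx0 E; have := inm z; rewrite !inE zx0 zJ -E eqxx => /(_ isT).
  case: (x =P x0) => [->|/eqP xx0]; case: (y =P x0) => [->|/eqP yy0] //.
  - by move/aux; move/(_ yJ yy0).
  - by move/esym/aux; move/(_ xJ xx0).
  - by apply: injm; rewrite !inE ?xx0 ?yy0.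
case: (x =P x0) => [->|/eqP xx0] //.
by have := inm x; rewrite !inE xx0 xJ => /(_ isT)/andP[].
Qed.

Lemma intermediate_set (T : finType) (X A : {set T}) n :
  X \subset A -> #|X| <= n <= #|A| -> exists S : {set T}, [/\ X \subset S, S \subset A & #|S| = n].
Proof.
move=> XA /andP[]; elim: n => [|n IH] hX hA.
  by exists set0; rewrite cards0 sub0set; split; rewrite // subset0 -cards_eq0 -leqn0.
move: hX; rewrite leq_eqVlt ltnS => /orP[/eqP hX|hX]; first by exists X.
have [S [XS SA cS]] := IH hX (ltnW hA).
have [x] : exists x, x \in A :\: S.
  by apply/set0Pn; rewrite setD_eq0; apply: contraL hA => /subset_leq_card; rewrite cS -leqNgt.
rewrite inE => /andP[xS xA]; exists (x |: S); split.
- exact: subset_trans XS (subsetUr _ _).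
- by rewrite subUset sub1set xA.
- by rewrite cardsU1 xS cS.
Qed.

Section Critical.
Variables (T : finType) (e : rel T).
Hypotheses (e_sym : symmetric e) (e_irr : irreflexive e).
Variable a : nat.
Hypothesis alpha_max : forall A, indep e A -> #|A| <= a.
Hypothesis critical : forall u w, e u w -> exists B, near e a B u w.
Local Notation near := (near e a).
Local Notation indep := (indep e).
Local Notation nbh := (nbh e).
Implicit Types (A B J K M S X : {set T}) (u v w x y : T).

(** A critical set at [v] in [J] yields a maximum independent set [A] without [v]. Exchange gives
    [#|J :\: A| <= #|A :&: nbh J|]; induction handles [J :&: A], whose neighbours lie outside
    [A]. *)
Lemma card_le_nbh J : indep J -> {in J, forall x, exists y, e x y} -> #|J| <= #|nbh J|.
Proof.
have [n] := ubnP #|J|; elim: n J => // n IH J; rewrite ltnS => Jn iJ noiso.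
have [->|[v vJ]] := set_0Vmem J; first by rewrite cards0.
have [u evu] := noiso v vJ; have [B nB] := critical evu.
case/and5P: nB => _ vB _ iA /andP[_ /eqP cB]; set A := B :\ v in iA.
have cA : #|A| = a by have := cardsD1 v B; rewrite vB cB -/A; clear; lia.
have iA' : indep (A :\: nbh J) by apply: indepS iA; apply: subsetDl.
have := exchange e_sym alpha_max iJ iA'; rewrite cA leq_add2l => ex.
have lt : #|J :&: A| < #|J|.
  apply: proper_card; rewrite properEneq subsetIl andbT; apply/eqP => /setP/(_ v).
  by rewrite !inE vJ eqxx.
have le : #|J :&: A| <= #|nbh (J :&: A)|.
  apply: IH; [exact: leq_trans lt Jn | by apply: indepS iJ; apply: subsetIl |].
  by move=> x; rewrite inE => /andP[xJ _]; apply: noiso.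
have : nbh (J :&: A) \subset nbh J :\: A.
  apply/subsetP => y yN; rewrite in_setD (subsetP (nbhS _ (subsetIl J A)) _ yN) andbT.
  case/nbhP: yN => x; rewrite in_setI => /andP[_ xA] exy.
  by apply/negP => yA; move/indepP: iA => /(_ x y xA yA); rewrite exy.
move/subset_leq_card; have := cardsID A J; have := cardsID A (nbh J).
rewrite (setIC (nbh J)); move: ex le; clear; lia.
Qed.

Lemma indep_matching J : indep J -> {in J, forall x, exists y, e x y} ->
  exists mu : T -> T, {in J &, injective mu} /\ {in J, forall x, e x (mu x)}.
Proof.
move=> iJ noiso; have [|mu [inj mem]] := @hall_marriage T (fun x => [set y | e x y]) J.
  move=> X XJ; have -> : \bigcup_(x in X) [set y | e x y] = nbh X.
    apply/setP => y; apply/bigcupP/nbhP => -[x xX].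
      by rewrite inE; exists x.
    by exists x; rewrite ?inE.
  apply: card_le_nbh; first exact: indepS iJ.
  by move=> x xX; apply: noiso; apply: (subsetP XJ).
by exists mu; split=> // x xJ; have := mem x xJ; rewrite inE.
Qed.

Definition isolated := [set x | [forall y, ~~ e x y]].

Lemma isolatedPn x : reflect (exists y, e x y) (x \notin isolated).
Proof. by rewrite inE negb_forall; apply: (iffP existsP) => -[y]; rewrite ?negbK; exists y; rewrite ?negbK. Qed.

Lemma nbh_isolated X : X \subset isolated -> nbh X = set0.
Proof.
move=> XI; apply/setP => y; rewrite in_set0; apply/negP => /nbhP[x /(subsetP XI)].
by rewrite inE => /forallP/(_ y)/negP.
Qed.

Lemma indepU_isolated A X : X \subset isolated -> indep A -> indep (A :|: X).
Proof.
move=> XI iA; apply: indepU => //; last by rewrite nbh_isolated // disjoints_subset setC0.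
by rewrite indep_nbh nbh_isolated // disjoints_subset setC0.
Qed.

Lemma isolated_sub A : indep A -> #|A| = a -> isolated \subset A.
Proof.
move=> iA cA; have := alpha_max (indepU_isolated (subxx _) iA); rewrite -cA => le.
have /eqP -> : A == A :|: isolated by rewrite eqEcard subsetUl.
exact: subsetUr.
Qed.

Section Stable.
Variables (k l h : nat).
Hypothesis k_eq : k = 2 * l + 2 + h.
Hypothesis stable : forall S, #|S| <= k ->
  exists A, [/\ indep A, [disjoint A & S] & a <= #|A| + l].

(** Delete [l + 1] isolated vertices: adding them back to a surviving independent set would exceed
    [a]. *)
Lemma card_isolated : #|isolated| <= l.
Proof.
rewrite leqNgt; apply/negP => lt.
have [|S [_ SI cS]] := @intermediate_set _ set0 isolated l.+1 (sub0set _).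
  by rewrite cards0.
have [|A [iA dA hA]] := stable (S := S); first by rewrite cS k_eq; clear; lia.
have := alpha_max (indepU_isolated SI iA); have := cardsUI A S.
by rewrite (disjoint_setI0 dA) cards0 cS; move: hA; clear; lia.
Qed.

(* Delete the closed neighbourhood of [J], except [#|J| - (l + 1)] matched pairs. *)
Lemma expansion J : indep J -> l < #|J| -> #|J| + h < #|nbh J|.
Proof.
move=> iJ lJ; rewrite ltnNge; apply/negP => hJ.
pose J' := J :\: isolated.
have iJ' : indep J' by apply: indepS iJ; apply: subsetDl.
have [|mu [mu_inj mu_e]] := indep_matching iJ'.
  by move=> x; rewrite in_setD => /andP[/isolatedPn].
have cJ' : #|J| <= #|J'| + l.
  have := card_isolated; have := subset_leq_card (subsetIr J isolated).
  by have := cardsID isolated J; rewrite -/J'; clear; lia.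
have [|Q [_ QJ cQ]] := @intermediate_set _ set0 J' (#|J| - l.+1) (sub0set _).
  by rewrite cards0; move: cJ'; clear; lia.
have QJ0 : Q \subset J by apply: subset_trans QJ (subsetDl _ _).
have muI : {in Q &, injective mu}.
  by move=> x y xQ yQ; apply: mu_inj; apply: (subsetP QJ).
have muN : mu @: Q \subset nbh J.
  apply/subsetP => _ /imsetP[x xQ ->]; apply/nbhP; exists x; last by apply/mu_e/(subsetP QJ).
  exact: (subsetP QJ0).
have dJN : [disjoint J & nbh J] by rewrite -indep_nbh.
pose S := (J :\: Q) :|: (nbh J :\: mu @: Q).
have cmu : #|mu @: Q| = #|Q| by apply: card_in_imset.
(* The size is at most [#|J| + #|nbh J| - 2 * #|Q|], hence at most [h + 2 * (l + 1) = k]. *)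
have cS : #|S| <= k.
  have : #|S| <= #|J :\: Q| + #|nbh J :\: mu @: Q| by apply: leq_card_setU.
  have := cardsID Q J; have := cardsID (mu @: Q) (nbh J).
  rewrite (setIidPr QJ0) (setIidPr muN) cmu cQ k_eq.
  by move: hJ lJ; clear; lia.
have [A [iA dA hA]] := stable cS.
have iAJ : indep (A :\: nbh J) by apply: indepS iA; apply: subsetDl.
have := exchange e_sym alpha_max iJ iAJ.
(* A surviving vertex of [nbh J] is matched to some [x] in [Q], and [A] cannot contain both. So
   exchange gains [#|J :\: A| - #|Q :\: A| = l + 1] vertices over [A]. *)
have AN : A :&: nbh J \subset mu @: (Q :\: A).
  apply/subsetP => y; rewrite in_setI => /andP[yA yN].
  have : y \notin S by move: dA; rewrite disjoints_subset => /subsetP/(_ y yA); rewrite inE.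
  rewrite in_setU negb_or => /andP[_]; rewrite in_setD yN andbT negbK => /imsetP[x xQ yx].
  apply/imsetP; exists x => //; rewrite in_setD xQ andbT; apply/negP => xA.
  by move/indepP: iA => /(_ x y xA yA); rewrite yx mu_e // (subsetP QJ).
have := leq_trans (subset_leq_card AN) (leq_imset_card _ _).
have JA : J :&: A \subset Q.
  apply/subsetP => y; rewrite in_setI => /andP[yJ yA].
  have : y \notin S by move: dA; rewrite disjoints_subset => /subsetP/(_ y yA); rewrite inE.
  by rewrite in_setU negb_or => /andP[]; rewrite in_setD yJ andbT negbK.
have QA : J :&: A = Q :&: A.
  apply/setP => y; rewrite !inE; case yA: (y \in A); rewrite ?andbF // !andbT.
  apply/idP/idP => [yJ|]; last exact: (subsetP QJ0).
  by apply: (subsetP JA); rewrite inE yJ.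
have := cardsID A J; have := cardsID A Q; rewrite QA cQ.
by move: hA lJ; clear; lia.
Qed.

End Stable.
End Critical.

(** * The bound *)

(** The added [D + 3] absorbs the constant terms, so each step of the recursion costs only a factor
    6. *)
Lemma pair_bound_le D l t : pair_bound D l t + D + 3 <= 6 ^ t * (l + D + 4).
Proof.
elim: t => [|t IH] /=; first by clear; lia.
by rewrite expnS -mulnA; apply: leq_trans (leq_mul (leqnn 6) IH); clear; lia.
Qed.

Section Bound.
Variables (T : finType) (e : rel T).
Hypotheses (e_sym : symmetric e) (e_irr : irreflexive e).
Variable a : nat.
Hypothesis alpha_max : forall A, indep e A -> #|A| <= a.
Hypothesis critical : forall u w, e u w -> exists B, near e a B u w.
Local Notation near := (near e a).
Local Notation indep := (indep e).
Local Notation nbh := (nbh e).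

Lemma critical_bound (I : {set T}) k l h r m :
  indep I -> #|I| = a -> k = 2 * l + 2 + h -> 0 < h -> m <= h + r ->
  #|T| <= 2 * a + m ->
  (forall S : {set T}, #|S| <= k ->
    exists A, [/\ indep A, [disjoint A & S] & a <= #|A| + l]) ->
  a <= 2 * l + r * (2 * (m + l) + 2 * pair_bound (m + l) l (r + r) + 3).
Proof.
move=> iI cI k_eq h_gt0 mr hn stable.
have expand := expansion e_sym alpha_max critical k_eq stable.
have cIso := card_isolated e_sym alpha_max k_eq stable.
set Iso := isolated e in cIso.
pose P := I :\: Iso.
have iP : indep P by apply: indepS iI; apply: subsetDl.
have cP : #|P| + #|Iso| = a.
  have IsoI : Iso \subset I by apply: isolated_sub iI cI.
  by have := cardsID Iso I; rewrite (setIidPr IsoI) -cI -/P; clear; lia.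
have [|mu [mu_inj mu_e]] := indep_matching e_sym alpha_max critical iP.
  by move=> x; rewrite in_setD => /andP[/isolatedPn].
(* The independent set [A] has at most one end of each matching edge. Every edge it misses must be
   paid for by a vertex of [A] outside [W], and [~: W] has at most [m + #|Iso|] vertices. *)
have missed B u w : near B u w ->
    #|[set p in P | (p \notin B) && (mu p \notin B)]| <= m + l.
  case/and5P => _ uB _ iA /andP[_ /eqP cB]; set A := B :\ u in iA.
  have cA : #|A| = a by have := cardsD1 u B; rewrite uB cB -/A; clear; lia.
  have IsoA := isolated_sub e_sym alpha_max iA cA; rewrite -/Iso in IsoA.
  set Z := [set p in P | _].
  have ZZ : Z \subset P :\: (P :&: A) :\: [set p in P | mu p \in A].
    apply/subsetP => p; rewrite !inE => /and3P[/andP[pI pP] pB mB].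
    by rewrite pI pP (negPf pB) (negPf mB) !andbF.
  have PA0 : (P :&: A) :&: [set p in P | mu p \in A] = set0.
    apply/setP => p; rewrite in_set0 !in_setI in_set; apply/negP => /andP[/andP[pP pA] /andP[_ mA]].
    by move/indepP: iA => /(_ _ _ pA mA); rewrite mu_e.
  have h1 : #|Z| + #|P :&: A| + #|[set p in P | mu p \in A]| <= #|P|.
    move: ZZ; rewrite setDDl; have := cardsUI (P :&: A) [set p in P | mu p \in A].
    rewrite PA0 cards0; set X := _ :|: _; have XP : X \subset P.
      by rewrite subUset subsetIl; apply/subsetP => p; rewrite in_set => /andP[].
    have := cardsID X P; rewrite (setIidPr XP) => c1 c2 /subset_leq_card.
    by move: c1 c2; clear; lia.
  have cmu : #|mu @: P| = #|P| by apply: card_in_imset.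
  have Pmu0 : P :&: mu @: P = set0.
    apply/setP => y; rewrite in_set0 in_setI; apply/negP => /andP[yP /imsetP[x xP yx]].
    by move/indepP: iP => /(_ x y xP yP); rewrite yx mu_e.
  have IsoN : Iso :&: (P :|: mu @: P) = set0.
    apply/setP => y; rewrite in_set0 in_setI in_setU; apply/negP => /andP[yIso].
    rewrite in_setD yIso /= => /imsetP[x xP yx].
    by move: yIso; rewrite inE => /forallP/(_ x); rewrite yx e_sym mu_e.
  pose W := Iso :|: (P :|: mu @: P).
  have cW : #|W| = #|Iso| + 2 * #|P|.
    by rewrite cardsU IsoN cards0 cardsU Pmu0 cards0 cmu; clear; lia.
  have cWT : #|W| + #|~: W| = #|T| by rewrite cardsC.
  have cAW : #|A| <= #|Iso| + #|P :&: A| + #|[set p in P | mu p \in A]| + #|~: W|.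
    apply: leq_trans (_ : #|Iso :|: (P :&: A) :|: mu @: [set p in P | mu p \in A] :|: ~: W| <= _); last first.
      by do 3! (apply: leq_trans (leq_card_setU _ _) _; apply: leq_add; rewrite ?leq_imset_card //).
    apply: subset_leq_card; apply/subsetP => y yA; rewrite !in_setU in_setI in_setC yA andbT.
    rewrite !in_setU; case: (y \in Iso) => //=; case: (y \in P) => //=; apply/orP.
    case: (boolP (y \in mu @: P)) => [/imsetP[x xP yx]|]; last by right.
    by left; apply/imsetP; exists x; rewrite // inE -yx yA xP.
  by move: h1 cW cWT cAW hn cIso; rewrite cA -cP; clear; lia.
have top A : indep A -> #|A| = a -> #|nbh A| <= #|A| + (h + r).
  move=> iA cA; have := max_card (A :|: nbh A).
  rewrite cardsU (_ : A :&: nbh A = set0); last by apply: disjoint_setI0; rewrite -indep_nbh.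
  by rewrite cards0 cA; move: hn mr; clear; lia.
have id_inj : {in P &, injective (@id T)} by [].
have := fiber_level e_sym e_irr alpha_max critical id_inj mu_inj mu_e missed h_gt0 expand top
  (leqnn r) iI (top I iI cI).
have : P \subset [set p in P | p \in I].
  by apply/subsetP => p pP; rewrite inE pP; move: pP; rewrite inE => /andP[].
move/subset_leq_card; move: cP cIso; clear; lia.
Qed.

End Bound.

(** Delete edges without a critical set one at a time. A newly independent set with more than [a]
    vertices would contain both ends of the deleted edge and be a critical set for it. *)
Lemma critical_subgraph (T : finType) (e : rel T) a :
  symmetric e -> irreflexive e -> (forall A, indep e A -> #|A| <= a) ->
  exists e' : rel T, [/\ symmetric e', irreflexive e', subrel e' e,
    forall A, indep e' A -> #|A| <= a &
    forall u w, e' u w -> exists B, near e' a B u w].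
Proof.
have [n] := ubnP #|[set p : T * T | e p.1 p.2]|.
elim: n e => // n IH e; rewrite ltnS => en e_sym e_irr amax.
case: (boolP [exists u, exists w, e u w && ~~ [exists B, near e a B u w]]); last first.
  move/existsPn => crit; exists e; split=> // u w euw.
  have /existsPn/(_ w) := crit u; rewrite euw /= negbK => /existsP[B nB].
  by exists B.
case/existsP => u /existsP[w /andP[euw /existsPn no]].
pose e2 x y := e x y && ~~ (((x == u) && (y == w)) || ((x == w) && (y == u))).
have sub2 : subrel e2 e by move=> x y /andP[].
have e2_sym : symmetric e2.
  by move=> x y; rewrite /e2 e_sym orbC [(y == w) && _]andbC [(y == u) && _]andbC.
have [||||e' [h1 h2 h3 h4 h5]] := IH e2.
- apply: leq_trans en; apply: proper_card; apply/properP; split.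
    by apply/subsetP => p; rewrite !inE => /sub2.
  by exists (u, w); rewrite inE //= /e2 euw !eqxx.
- exact: e2_sym.
- by move=> x; rewrite /e2 e_irr.
- move=> A iA; rewrite leqNgt; apply/negP => ltA.
  have iAuw x : x \in [:: u; w] -> indep e (A :\ x).
    move=> xuw; apply/indepP => y z; rewrite !in_setD1 => /andP[yx yA] /andP[zx zA].
    move/indepP: iA => /(_ y z yA zA); apply: contra => eyz; rewrite /e2 eyz /=.
    by apply/negP; move: xuw yx zx; rewrite !inE => /orP[] /eqP-> yx zx; rewrite (negPf yx) (negPf zx) ?andbF.
  have cA x : x \in [:: u; w] -> x \in A /\ #|A| = a.+1.
    move=> xuw; have := amax _ (iAuw x xuw); have := cardsD1 x A; move: ltA.
    by case: (x \in A); clear; [split=> //; lia | lia].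
  have [|uA cA'] := cA u; first by rewrite inE eqxx.
  have [|wA _] := cA w; first by rewrite !inE eqxx orbT.
  by have := no A; rewrite /near euw uA wA cA' eqxx !iAuw // !inE eqxx ?orbT.
by exists e'; split=> // x y /h3/sub2.
Qed.

Lemma bound_numeric q l m a n :
  2 * q + 3 <= m -> n <= 2 * a + m ->
  a <= 2 * l + (2 * q + 2) * (2 * (m + l) +
        2 * pair_bound (m + l) l (2 * q + 2 + (2 * q + 2)) + 3) ->
  n <= (q + 1) * (l + 1) * (m - 1) ^ 2 * 2 ^ (6 * m ^ 2).
Proof.
move=> qm hn ha; set t := 2 * q + 2 + (2 * q + 2) in ha.
have hb := pair_bound_le (m + l) l t.
set N := 6 ^ t * _ in hb.
have hN : n <= 20 * (q + 1) * N.
  have N1 : 2 * l + m + 4 <= N.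
    by rewrite /N (_ : l + (m + l) + 4 = 2 * l + m + 4) ?leq_pmull ?expn_gt0 //; clear; lia.
  have : a <= 2 * l + (2 * q + 2) * (2 * N + 2 * N).
    apply: leq_trans ha _; rewrite leq_add2l leq_mul2l; apply/orP; right.
    by move: hb N1; clear; lia.
  by move: hn N1; clear; nia.
apply: leq_trans hN _.
(* Bound 6 by [2 ^ 3]; then [3 * t = 12 * (q + 1)] is at most [6 * (m - 1)] by [qm]. *)
have t2 : 6 ^ t <= 2 ^ (6 * (m - 1)).
  apply: leq_trans (_ : 2 ^ (3 * t) <= _); first by rewrite expnM leq_exp2r // /t !addn2.
  by rewrite leq_exp2l //; move: qm; rewrite /t; clear; lia.
have m2 : m + 4 <= 2 ^ (m + 2).
  by elim: (m) => // i; rewrite addSn addSn expnS; clear; lia.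
have lm : l + (m + l) + 4 <= (l + 1) * (m + 4) by clear; nia.
have -> : (q + 1) * (l + 1) * (m - 1) ^ 2 * 2 ^ (6 * m ^ 2) =
  (q + 1) * ((l + 1) * ((m - 1) ^ 2 * 2 ^ (6 * m ^ 2))) by rewrite !mulnA.
rewrite -mulnA mulnCA leq_mul2l; apply/orP; right.
apply: leq_trans (_ : 2 ^ 5 * (2 ^ (6 * (m - 1)) * ((l + 1) * 2 ^ (m + 2))) <= _).
  rewrite leq_mul // /N leq_mul // (leq_trans lm) // leq_mul2l m2 orbT //.
rewrite [_ * ((l + 1) * _)]mulnCA [2 ^ 5 * _]mulnCA leq_mul2l; apply/orP; right.
rewrite -!expnD; apply: leq_trans (_ : 2 ^ (6 * m ^ 2) <= _).
  by rewrite leq_exp2l //; move: qm; clear; nia.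
by rewrite leq_pmull // expn_gt0; apply/orP; left; move: qm; clear; lia.
Qed.

Theorem theorem1p9 (k l q : nat) (hkl : 2 * l + 3 <= k) (G : sgraph)
    (hG : q_tight q k l G) :
  #|G| <= (q + 1) * (l + 1) * (k + 2 * q - 2 * l - 1) ^ 2
          * 2 ^ (6 * (k + 2 * q - 2 * l) ^ 2).
Proof.
case: hG => stable tight.
set m := k + 2 * q - 2 * l.
have qm : 2 * q + 3 <= m by rewrite /m; move: hkl; clear; lia.
(* The floor is at least [(n - k) / 2], where [n] is the order of [G]. *)
have hn : #|G| <= 2 * alpha G + m by move: tight; rewrite /m; clear; lia.
have amax A : indep (@edge G) A -> #|A| <= alpha G.
  by move=> iA; rewrite /alpha; apply: (@leq_bigmax_cond _ (@independent G) (fun I : {set G} => #|I|)).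
have [I iI cI] : exists2 I : {set G}, independent I & #|I| = alpha G.
  have [|I iI cI] := @eq_bigmax_cond _ (@independent G) (fun I : {set G} => #|I|).
    by apply/card_gt0P; exists set0; apply/forall_inP => x; rewrite inE.
  by exists I; rewrite // -cI.
have [e [e_sym e_irr sub emax crit]] := critical_subgraph (@edge_sym G) (@edge_irrefl G) amax.
have mono A : indep (@edge G) A -> indep e A.
  move=> /indepP iA; apply/indepP => x y xA yA; apply: contra (iA x y xA yA); exact: sub.
(* A graph with fewer than [k] vertices is stable vacuously, but then its order is at most
   [2 * l + m], so the numeric bound applies with [a := l]. *)
have [kn|nk] := leqP k #|G|; last first.
  apply: (bound_numeric (l := l) (a := l) qm).
    by move: nk hkl; rewrite /m; clear; lia.
  by apply: leq_trans (leq_addr _ _); rewrite leq_pmull.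
apply: (bound_numeric qm hn).
(* Here [r = 2 * q + 2], so that [h + r = m]. *)
apply: (critical_bound e_sym e_irr emax crit (mono I iI) cI (k := k) (h := k - 2 * l - 2)) => //.
- by move: hkl; clear; lia.
- by move: hkl; clear; lia.
- by move: hkl; rewrite /m; clear; lia.
(* Stability speaks of exactly [k] deleted vertices, so [S] is first enlarged to that size. *)
move=> S cS; have [|S' [SS' _ cS']] := @intermediate_set _ S [set: G] k (subsetT _).
  by rewrite cS cardsT.
have := stable S' cS'; have [|J iJ cJ] := @eq_bigmax_cond _ (@independent (del_vertices S')) (fun I : {set _} => #|I|).
  by apply/card_gt0P; exists set0; apply/forall_inP => x; rewrite inE.
rewrite {2}/alpha cJ => hJ; exists [set val x | x in J]; split.
- apply: mono; apply/indepP => _ _ /imsetP[x xJ ->] /imsetP[y yJ ->].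
  by move/forall_inP: iJ => /(_ x xJ)/forall_inP/(_ y yJ).
- rewrite disjoints_subset; apply/subsetP => _ /imsetP[x xJ ->]; rewrite inE.
  by have := valP x; rewrite inE; apply: contra; apply: (subsetP SS').
- by rewrite card_imset; [rewrite addnC -leq_subLR | apply: val_inj].
Qed.
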